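(* The following statements hold for completely regular Hausdorff spaces. (1) Every cozero-complemented space is a $WCF$-space. (2) A $WCF$-space $X$ that is also a quasi $F$-space is an $F'$-space.
   Context: For a space $X$, $C(X)$ is the ring of real-valued continuous functions on $X$. For $f\in C(X)$, the zero-set of $f$ is $Z(f)=f^{-1}(\{0\})$ and the cozero-set of $f$ is $\mathrm{Coz}(f)=X\setminus Z(f)$. $X$ is a $WCF$-space if for every two disjoint cozero-sets $A,B$ of $X$ there exist zero-sets $Z_1,Z_2$ of $X$ with $A\subseteq Z_1$, $B\subseteq Z_2$ and $\mathrm{int}\,Z_1\cap \mathrm{int}\,Z_2=\emptyset$. $X$ is cozero-complemented if for each $f\in C(X)$ there is $g\in C(X)$ such that $\mathrm{Coz}(f)\cup\mathrm{Coz}(g)$ is dense in $X$ and $\mathrm{Coz}(f)\cap\mathrm{Coz}(g)=\emptyset$. $X$ is a quasi $F$-space if each dense cozero-set of $X$ is $C^*$-embedded in $X$ (every bounded continuous real function on it extends continuously to $X$). $X$ is an $F'$-space if any two disjoint cozero-sets of $X$ have disjoint closures. *)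

(* Defs.v *)
From mathcomp Require Import all_boot all_order all_algebra.
From mathcomp Require Import all_classical all_reals all_analysis.
Set Implicit Arguments.
Unset Strict Implicit.
Unset Printing Implicit Defensive.
Import Order.TTheory GRing.Theory Num.Theory.
Import numFieldNormedType.Exports.
Local Open Scope classical_set_scope.
Local Open Scope ring_scope.

Definition zeros (R : realType) (X : topologicalType) (f : X -> R) : set X :=
  f @^-1` [set 0].

Definition Coz (R : realType) (X : topologicalType) (f : X -> R) : set X :=
  ~` zeros f.

Definition zero_set (R : realType) (X : topologicalType) (A : set X) : Prop :=
  exists2 f : X -> R, continuous f & A = zeros f.

Definition cozero_set (R : realType) (X : topologicalType) (A : set X) : Prop :=
  exists2 f : X -> R, continuous f & A = Coz f.

Definition WCF_space (R : realType) (X : topologicalType) : Prop :=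
  forall A B : set X, cozero_set R A -> cozero_set R B -> A `&` B = set0 ->
  exists Z1 Z2 : set X,
    [/\ zero_set R Z1, zero_set R Z2, A `<=` Z1, B `<=` Z2 &
        interior Z1 `&` interior Z2 = set0].

Definition cozero_complemented (R : realType) (X : topologicalType) : Prop :=
  forall f : X -> R, continuous f ->
  exists g : X -> R,
    [/\ continuous g, dense (Coz f `|` Coz g) & Coz f `&` Coz g = set0].

(* A continuous function on the subspace S is represented by a total function
   on X, continuous for the subspace topology of S; its values outside S are
   irrelevant. *)
Definition Cstar_embedded (R : realType) (X : topologicalType) (S : set X) :
    Prop :=
  forall h : X -> R, {within S, continuous h} -> [bounded h x | x in S] ->
  exists2 g : X -> R, continuous g & forall x, S x -> g x = h x.

Definition quasi_F_space (R : realType) (X : topologicalType) : Prop :=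
  forall S : set X, cozero_set R S -> dense S -> Cstar_embedded R S.

Definition F'_space (R : realType) (X : topologicalType) : Prop :=
  forall A B : set X, cozero_set R A -> cozero_set R B -> A `&` B = set0 ->
  closure A `&` closure B = set0.

(* Main.v *)
Require Import Defs.
From mathcomp Require Import all_boot all_order all_algebra.
From mathcomp Require Import all_classical all_reals all_analysis.
Import Order.TTheory GRing.Theory Num.Theory.
Import numFieldNormedType.Exports.
Local Open Scope classical_set_scope.
Local Open Scope ring_scope.

(** For (1), given disjoint [Coz f] and [Coz f'] and a complement [g] of [f],
    take the zero-sets of [g] and of [f]: a point in both interiors would have
    a neighbourhood missing the dense set [Coz f `|` Coz g].
    For (2), let [Z(u)], [Z(v)] be the zero-sets that WCF provides for [A] and
    [B]. Then [Coz (u^2 + v^2)] is dense, and on it [u^2 / (u^2 + v^2)] is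
    continuous with values in [0, 1], equal to 0 on [A] and to 1 on [B]. Its
    continuous extension to the space separates the closures. *)

Lemma open_Coz (R : realType) (X : topologicalType) (f : X -> R) :
  continuous f -> open (Coz f).
Proof.
move=> cf; rewrite /Coz openC; apply: preimage_closed => [x _|]; first exact: cf.
exact: closed_eq.
Qed.

Lemma Coz_sumsq (R : realType) (X : topologicalType) (u v : X -> R) :
  Coz (fun x => u x ^+ 2 + v x ^+ 2) = Coz u `|` Coz v.
Proof.
rewrite /Coz -setCI; congr (~` _); apply/seteqP; split=> x /=.
  move/eqP; rewrite paddr_eq0 ?sqr_ge0// !sqrf_eq0.
  by case/andP => /eqP u0 /eqP v0; split.
by rewrite /zeros /= => -[-> ->]; rewrite expr0n addr0.
Qed.

(** An open set missing both cozero-sets lies in [zeros u] and in [zeros v], hence in both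
    interiors. *)
Lemma dense_CozU (R : realType) (X : topologicalType) (u v : X -> R) :
  interior (zeros u) `&` interior (zeros v) = set0 -> dense (Coz u `|` Coz v).
Proof.
move=> uv0 O [x Ox] oO; apply: contrapT => /nonemptyPn; rewrite /Coz -setCI.
move/disjoints_subset; rewrite setCK => Ouv.
suff : (interior (zeros u) `&` interior (zeros v)) x by rewrite uv0.
by rewrite -interiorI; move: x Ox; move: Ouv; rewrite open_subsetE.
Qed.

Lemma interior_zerosI (R : realType) (X : topologicalType) (u v : X -> R) :
  dense (Coz u `|` Coz v) -> interior (zeros u) `&` interior (zeros v) = set0.
Proof.
move=> duv; apply/eqP; apply/negPn/negP => /set0P ne.
have [x [[/interior_subset ux /interior_subset vx]]] :=
  duv _ ne (openI (open_interior _) (open_interior _)).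
by case; exact.
Qed.

(** If [k x] differed from [c], the open set where [k] is not [c] would meet [A], and the open
    intersection would meet [S]. This carries values known only on a dense set to the closure of
    [A]. *)
Lemma dense_eq_cst_closure (R : realType) (X : topologicalType)
    (A S : set X) (k : X -> R) (c : R) :
  continuous k -> open A -> dense S -> (forall x, A x -> S x -> k x = c) ->
  forall x, closure A x -> k x = c.
Proof.
move=> ck oA dS kc x clAx; apply: contrapT => kxc.
have oO : open (Coz (fun y => k y - c)).
  by apply: open_Coz => y; apply: cvgB; [exact: ck|exact: cvg_cst].
have Ox : Coz (fun y => k y - c) x by move=> /subr0_eq.
have [y [[Ay Oy] Sy]] := dS _ (clAx _ (open_nbhs_nbhs (conj oO Ox))) (openI oA oO).
by apply: Oy; rewrite /zeros /= kc ?subrr.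
Qed.

Lemma cozero_complemented_WCF (R : realType) (X : topologicalType) :
  cozero_complemented R X -> WCF_space R X.
Proof.
move=> cc A B [f cf ->] [f' _ ->] ff'0.
have [g [cg dfg fg0]] := cc f cf.
(* The roles swap: [Coz f] avoids [Coz g], so it lies in [zeros g], and [Coz f'] lies in
   [zeros f]. *)
exists (zeros g), (zeros f); split; [by exists g|by exists f| | |].
- by rewrite -(setCK (zeros g)); exact/disjoints_subset.
- by rewrite -(setCK (zeros f)); apply/disjoints_subset; rewrite setIC.
- by rewrite setIC; exact: interior_zerosI.
Qed.

Lemma WCF_quasi_F_F' (R : realType) (X : topologicalType) :
  WCF_space R X -> quasi_F_space R X -> F'_space R X.
Proof.
move=> wcf qF A B cA cB AB0.
have [_ [_ [[u cu ->] [v cv ->] Au Bv uv0]]] := wcf A B cA cB AB0.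
have oA : open A by case: cA => f cf ->; exact: open_Coz.
have oB : open B by case: cB => f cf ->; exact: open_Coz.
pose w x := u x ^+ 2 + v x ^+ 2.
have w_ge0 x : 0 <= w x by rewrite addr_ge0 ?sqr_ge0.
have cu2 : continuous (fun x => u x ^+ 2).
  by move=> x; apply: cvgM; exact: cu.
have cw : continuous w.
  by move=> x; apply: cvgD; [exact: cu2|apply: cvgM; exact: cv].
have dS : dense (Coz w) by rewrite Coz_sumsq; exact: dense_CozU.
(* Where [w] vanishes the quotient takes the default value 0; only its values on [Coz w] matter. *)
pose h x := u x ^+ 2 / w x.
have ch : {within Coz w, continuous h}.
  apply: continuous_in_subspaceT => x /set_mem wx.
  by apply: cvgM; [exact: cu2|apply: cvgV; [exact/eqP|exact: cw]].
have bh : [bounded h x | x in Coz w].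
  exists 1; split; first exact: real1.
  move=> M M1 x /= wx; rewrite ger0_norm ?divr_ge0 ?sqr_ge0// (le_trans _ (ltW M1))//.
  have w0 : 0 < w x by rewrite lt_neqAle w_ge0 andbT eq_sym; exact/eqP.
  by rewrite ler_pdivrMr// mul1r lerDl sqr_ge0.
have [k ck kh] := qF _ (ex_intro2 _ _ w cw erefl) dS h ch bh.
have kA := dense_eq_cst_closure R X _ _ k 0 ck oA dS _.
have kB := dense_eq_cst_closure R X _ _ k 1 ck oB dS _.
apply/disjoints_subset => x clA clB.
(* At a common point of the closures [k] would be both 0 and 1. It remains to compute [h]: its
   numerator vanishes on [A], while on [B] the denominator reduces to [u ^+ 2], nonzero inside
   [Coz w]. *)
have /eqP := oner_neq0 R; apply; rewrite -(kB _ x clB) ?(kA _ x clA)// => y.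
- by move=> /Au uy /kh ->; rewrite /h uy expr0n mul0r.
- move=> /Bv vy wy; rewrite kh// /h /w vy expr0n addr0 divff//.
  by apply/eqP => u0; apply: wy; rewrite /zeros /= /w vy u0 expr0n addr0.
Qed.

Theorem proposition3p6 (R : realType) (X : topologicalType)
    (crX : completely_regular_space X) (hX : hausdorff_space X) :
  (cozero_complemented R X -> WCF_space R X) /\
  (WCF_space R X -> quasi_F_space R X -> F'_space R X).
Proof.
by split; [exact: cozero_complemented_WCF|exact: WCF_quasi_F_F'].
Qed.
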